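(* For all integers $n\ge 0$ and $t\ge 0$, the following hold. (i) $B_{55}^{(55t+21)}(55n+\alpha)\equiv 0\pmod{55}$ for every $\alpha\in\{9,14,19,39,54\}$. (ii) $B_{55}^{(55t+32)}(55n+\alpha)\equiv 0\pmod{55}$ for every $\alpha\in\{3,8,9,14,17,19,28,32,39,42,43,47,52,53,54\}$. (iii) $B_{55}^{(55t+54)}(55n+\alpha)\equiv 0\pmod{55}$ for every $\alpha\in\{3,8,9,14,19,28,39,43,53,54\}$.
   Context: For positive integers $\ell,r$ and an integer $n\ge 0$, $B_\ell^{(r)}(n)$ denotes the number of $\ell$-regular $r$-multipartitions of $n$, i.e. ordered $r$-tuples $(\lambda^{(1)},\dots,\lambda^{(r)})$ of (possibly empty) integer partitions, each having no part divisible by $\ell$, whose sizes sum to $n$; $B_\ell^{(r)}(0)=1$. Equivalently, as formal power series, $$\sum_{n=0}^\infty B_\ell^{(r)}(n)q^n=\frac{E_\ell^r}{E_1^r},\qquad E_k:=\prod_{m=1}^\infty(1-q^{km}).$$ *)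

(* Defs.v *)
From mathcomp Require Import all_boot.
Set Implicit Arguments.
Unset Strict Implicit.
Unset Printing Implicit Defensive.

(* A partition is the weakly decreasing sequence of its (positive) parts. *)
Definition is_partition (p : seq nat) : bool := sorted geq p && (0 \notin p).

Definition regular (l : nat) (p : seq nat) : bool :=
  all (fun k => ~~ (l %| k)) p.

Definition regular_multipartition (l r n : nat) (L : r.-tuple (seq nat)) : bool :=
  all (fun p => is_partition p && regular l p) L && (\sum_(p <- L) sumn p == n).

(* A partition of an integer m <= n has at most n parts, all at most n, so it is
   (the image of) an element of the finite type n.-bseq 'I_n.+1. *)
Definition parts (n : nat) (p : n.-bseq 'I_n.+1) : seq nat := map val p.

Definition B (l r n : nat) : nat :=
  #|[set L : r.-tuple (n.-bseq 'I_n.+1) |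
      regular_multipartition l n (map_tuple (@parts n) L)]|.

(* The bounds built into the finite type used in B lose nothing. *)
Lemma parts_inj n : injective (@parts n).
Proof. by move=> p q /(inj_map val_inj) /val_inj. Qed.

Lemma sumn_ge_size (p : seq nat) : 0 \notin p -> size p <= sumn p.
Proof.
elim: p => //= x p IH; rewrite inE negb_or eq_sym -lt0n => /andP[x0 /IH le].
by rewrite -add1n leq_add.
Qed.

Lemma sumn_ge_mem (p : seq nat) x : x \in p -> x <= sumn p.
Proof.
elim: p => //= y p IH; rewrite inE => /orP[/eqP->|/IH le].
  exact: leq_addr.
by apply: leq_trans le (leq_addl _ _).
Qed.

Lemma parts_onto n (p : seq nat) :
  is_partition p -> sumn p <= n -> exists q : n.-bseq 'I_n.+1, parts q = p.
Proof.
move=> /andP[_ p0] le_pn.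
have sz : size (map (@inord n) p) <= n.
  by rewrite size_map; apply: leq_trans (sumn_ge_size p0) le_pn.
exists (Bseq sz); rewrite /parts /= -map_comp -[RHS]map_id.
apply/eq_in_map => x /sumn_ge_mem le_x /=.
by rewrite inordK // ltnS (leq_trans le_x).
Qed.

Lemma B_size (l r n : nat) (s : seq (r.-tuple (seq nat))) :
  uniq s -> (forall L, (L \in s) = regular_multipartition l n L) ->
  B l r n = size s.
Proof.
move=> us ms; rewrite /B cardE -(size_map (map_tuple (@parts n))).
apply/perm_size/uniq_perm => // [|L].
  rewrite map_inj_uniq ?enum_uniq // => L M /(congr1 val) /=.
  by move=> /(inj_map (@parts_inj n)) /val_inj.
rewrite ms; apply/mapP/idP => [[M + ->]|HL]; first by rewrite mem_enum inE.
suff [M eM] : exists M : r.-tuple (n.-bseq 'I_n.+1), map_tuple (@parts n) M = L.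
  by exists M; rewrite ?mem_enum ?inE eM.
case/andP: HL => /allP HL /eqP HS.
have ex i : exists q : n.-bseq 'I_n.+1, parts q == tnth L i.
  have /HL/andP[Lp _] := mem_tnth i L.
  have [|q <-] := @parts_onto n _ Lp; last by exists q.
  rewrite -HS big_tuple (bigD1 i) //=; exact: leq_addr.
exists [tuple xchoose (ex i) | i < r].
apply: eq_from_tnth => i; rewrite tnth_map tnth_mktuple.
exact/eqP/(xchooseP (ex i)).
Qed.

(* Main.v *)
(** Write r + s = p k, where p is 5 or 11 and s is 1, 3 or 4, and let
    P = E_55 / E_1 be the generating function of 55-regular partitions.  Modulo
    p, Frobenius turns E_1^(r+s) into a series in X^p, and E_55 is a series in
    X^p as well; so P^r times a unit series in X^p equals E_1^s times a series
    in X^p, and it suffices that E_1^s has no exponents in the residue class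
    of 55n + a.  For s = 1 and s = 3 this follows from the identities of Euler
    and Jacobi: 24 i + 1 (resp. 8 i + 1) must be a square at an exponent i,
    and Jacobi's coefficient at i squares to 8 i + 1.  The case s = 4 is the
    product of these two.  Both identities are obtained, up to any power of X,
    from the finite q-binomial theorem. *)
Require Import Defs.
From mathcomp Require Import all_boot all_algebra zify ring.
Set Implicit Arguments.
Unset Strict Implicit.
Unset Printing Implicit Defensive.
Import Num.Theory GRing.Theory.
Local Open Scope ring_scope.

(** * Power series modulo X^N and residue classes of exponents *)

Section Truncation.
Variable R : comNzRingType.
Implicit Types (p q A U V : {poly R}) (d c N : nat).

(* Congruence modulo X^N. *)
Definition eqt N p q := forall i, (i < N)%N -> p`_i = q`_i.

Lemma eqt_sym N p q : eqt N p q -> eqt N q p.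
Proof. by move=> e i lt; rewrite e. Qed.

Lemma eqt_trans N p q A : eqt N p q -> eqt N q A -> eqt N p A.
Proof. by move=> e e' i lt; rewrite e ?e'. Qed.

Lemma eqtM N p q p' q' : eqt N p q -> eqt N p' q' -> eqt N (p * p') (q * q').
Proof.
move=> e e' i lt; rewrite !coefM; apply: eq_bigr => j _; have := ltn_ord j.
by move=> lej; rewrite e ?e' //; lia.
Qed.

Lemma eqtX N p q n : eqt N p q -> eqt N (p ^+ n) (q ^+ n).
Proof. by move=> e; elim: n => // n IH; rewrite !exprS; apply: eqtM. Qed.

Lemma eqt_prod N (I : Type) (s : seq I) (P : pred I) (f g : I -> {poly R}) :
  (forall i, P i -> eqt N (f i) (g i)) ->
  eqt N (\prod_(i <- s | P i) f i) (\prod_(i <- s | P i) g i).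
Proof. by move=> e; apply: (big_ind2 (eqt N)) => // *; apply: eqtM. Qed.

Definition supp d U := forall i, ~~ (d %| i)%N -> U`_i = 0.

Lemma suppM d p q : supp d p -> supp d q -> supp d (p * q).
Proof.
move=> sp sq i ndi; rewrite coefM big1 // => j _.
have [dj|/sp->] := boolP (d %| j)%N; last by rewrite mul0r.
rewrite sq ?mulr0 //; apply: contra ndi => dij.
by rewrite -(@subnKC j i) ?dvdn_add // -ltnS.
Qed.

Lemma supp1 d : supp d 1.
Proof. by case=> [|i]; rewrite ?dvdn0 // coef1. Qed.

Lemma supp_prod d (I : Type) (s : seq I) (P : pred I) (f : I -> {poly R}) :
  (forall i, P i -> supp d (f i)) -> supp d (\prod_(i <- s | P i) f i).
Proof.
by move=> e; apply: (big_ind (supp d)) => //; [apply: supp1|apply: suppM].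
Qed.

Lemma suppX d p n : supp d p -> supp d (p ^+ n).
Proof. by move=> e; elim: n => [|n IH]; rewrite ?exprS; [exact: supp1|exact: suppM]. Qed.

Lemma supp_1subXn d m : (d %| m)%N -> supp d (1 - 'X^m).
Proof.
move=> dm i ndi; rewrite coefB coef1 coefXn.
have -> : (i == m) = false by apply: contraNF ndi => /eqP->.
have -> : (i == 0)%N = false by apply: contraNF ndi => /eqP->.
by rewrite subrr.
Qed.

Lemma class_mulr d c N A V : supp d V ->
  (forall i, (i < N)%N -> i = c %[mod d] -> A`_i = 0) ->
  forall i, (i < N)%N -> i = c %[mod d] -> (A * V)`_i = 0.
Proof.
move=> sV cA i lt ic; rewrite coefM big1 // => j _.
have le : (j <= i)%N by rewrite -ltnS.
have [dij|/sV->] := boolP (d %| i - j)%N; last by rewrite mulr0.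
rewrite cA ?mul0r //; first exact: leq_ltn_trans lt.
by apply/eqP; rewrite -ic eq_sym eqn_mod_dvd.
Qed.

(** The coefficient of [A * U] at [i] is that of [A] plus terms at smaller exponents of the same
    class, so strong induction on [i] applies. *)
Lemma class_cancel d c N A U : supp d U -> U`_0 = 1 ->
  (forall i, (i < N)%N -> i = c %[mod d] -> (A * U)`_i = 0) ->
  forall i, (i < N)%N -> i = c %[mod d] -> A`_i = 0.
Proof.
move=> sU U0 cA; elim/ltn_ind => i IH lt ic.
have := cA i lt ic; rewrite coefM big_ord_recr /= subnn U0 mulr1.
rewrite big1 ?add0r // => j _.
have le : (j <= i)%N by apply: ltnW.
have [dij|/sU->] := boolP (d %| i - j)%N; last by rewrite mulr0.
rewrite IH ?mul0r //; first exact: ltn_trans lt.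
by apply/eqP; rewrite -ic eq_sym eqn_mod_dvd.
Qed.

Lemma eqt_cancel N p q U : U`_0 = 1 -> eqt N (p * U) (q * U) -> eqt N p q.
Proof.
move=> U0 e i lt; apply/subr0_eq; rewrite -coefB.
(* With [d = 1] there is a single residue class, so no exponent is excluded. *)
apply: (@class_cancel 1 0 N _ U) => // [j|j ltj _|]; rewrite ?dvd1n ?modn1 //.
by rewrite mulrBl coefB e ?subrr.
Qed.

Lemma coef0_prod1 (I : Type) (s : seq I) (P : pred I) (f : I -> {poly R}) :
  (forall i, P i -> (f i)`_0 = 1) -> (\prod_(i <- s | P i) f i)`_0 = 1.
Proof.
move=> e; apply: (big_ind (fun u : {poly R} => u`_0 = 1)) => //.
  by rewrite coef1.
by move=> p q; rewrite coef0M => -> ->; rewrite mulr1.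
Qed.

Lemma coef0_1subXn m : (0 < m)%N -> (1 - 'X^m : {poly R})`_0 = 1.
Proof. by case: m => // m _; rewrite coefB coef1 coefXn subr0. Qed.

Lemma eqt_1subXn N m : (N <= m)%N -> eqt N (1 - 'X^m) 1.
Proof.
by move=> le i lt; rewrite coefB coefXn ltn_eqF ?subr0 //; apply: leq_trans le.
Qed.

End Truncation.

(** * Gaussian binomials and the q-binomial theorem *)

Section QBinomial.
Variable R : comNzRingType.
Implicit Types (q y z : R) (m k n : nat).

Definition qpoch q m := \prod_(i < m) (1 - q ^+ i.+1).

Fixpoint qbin q m k : R :=
  match m, k with
  | _, 0 => 1
  | 0, _.+1 => 0
  | m'.+1, k'.+1 => qbin q m' k'.+1 + q ^+ (m' - k') * qbin q m' k'
  end.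

Lemma qbin0 q m : qbin q m 0 = 1. Proof. by case: m. Qed.

Lemma qbin_small q m k : (m < k)%N -> qbin q m k = 0.
Proof.
elim: m k => [|m IH] [|k] //= lt.
by rewrite !IH ?mulr0 ?addr0 //; lia.
Qed.

Lemma qpochS q m : qpoch q m.+1 = qpoch q m * (1 - q ^+ m.+1).
Proof. by rewrite /qpoch big_ord_recr. Qed.

(** The Pascal terms combine through 1 - q^(m+1) = (1 - q^(m-k)) + q^(m-k) (1 - q^(k+1)). *)
Lemma qbin_qpoch q m k : (k <= m)%N ->
  qbin q m k * (qpoch q k * qpoch q (m - k)) = qpoch q m.
Proof.
elim: m k => [|m IH] [|k] // le.
- by rewrite /qpoch !big_ord0 !mul1r.
- by rewrite qbin0 {1}/qpoch big_ord0 !mul1r.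
rewrite /=.
rewrite subSS mulrDl; have [mk|ltkm] := leqP m k.
  have -> : k = m by lia.
  rewrite subnn qbin_small // mul0r add0r expr0 mul1r [RHS]qpochS.
  by rewrite -[in RHS](IH m) // subnn; rewrite [qpoch q 0]big_ord0 qpochS; ring.
have e1 := IH k.+1 ltkm; have e0 := IH k (ltnW ltkm).
have em : q ^+ m.+1 = q ^+ (m - k) * q ^+ k.+1.
  by rewrite -exprD addnS subnK 1?ltnW.
have ek : qpoch q (m - k) = qpoch q (m - k.+1) * (1 - q ^+ (m - k)).
  by rewrite -{1 2}(subnSK ltkm) qpochS.
transitivity (qbin q m k.+1 * (qpoch q k.+1 * qpoch q (m - k.+1)) * (1 - q ^+ (m - k))
  + qbin q m k * (qpoch q k * qpoch q (m - k)) * (q ^+ (m - k) * (1 - q ^+ k.+1))).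
  by rewrite ek (qpochS q k); ring.
by rewrite e0 e1 [RHS]qpochS em; ring.
Qed.

(** The variable is kept formal so that the identity can be both evaluated and differentiated. *)
Lemma q_binomial q y m :
  \prod_(i < m) (y%:P + (q ^+ i) *: 'X) =
  \sum_(k < m.+1) (q ^+ 'C(k, 2) * qbin q m k * y ^+ (m - k)) *: 'X^k.
Proof.
elim: m => [|m IH].
  by rewrite big_ord0 big_ord1 bin0n subnn qbin0 !mulr1 scale1r.
rewrite big_ord_recr /= IH mulrDr [RHS]big_ord_recl.
rewrite [X in X * _ + _ = _]big_ord_recl mulrDl.
rewrite [X in _ + X + _ = _](_ : _ = \sum_(k < m.+1)
    (q ^+ 'C(k.+1, 2) * qbin q m k.+1 * y ^+ (m - k)) *: 'X^(k.+1)); last first.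
  rewrite mulr_suml [RHS]big_ord_recr /= qbin_small // mulr0 mul0r scale0r addr0.
  apply: eq_bigr => k _; rewrite -scalerAl [_ * y%:P]mulrC mul_polyC scalerA.
  congr (_ *: _); rewrite /bump add1n -(subnSK (ltn_ord k)) exprS; ring.
rewrite mulr_suml -addrA -big_split /=; congr (_ + _).
  rewrite !qbin0 !subn0 mulrC mul_polyC scalerA /=.
  by congr (_ *: _); rewrite exprS; ring.
apply: eq_bigr => k _; have le := ltn_ord k.
rewrite /bump add1n subSS -scalerAl -scalerAr scalerA -exprSr -scalerDl.
congr (_ *: _); rewrite binS bin1 /= mulrDr mulrDl; congr (_ + _).
rewrite -!mulrA [_ * q ^+ m]mulrC mulrCA [in q ^+ m](_ : m = k + (m - k))%N; last lia.
by rewrite !exprD; ring.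
Qed.

Lemma q_binomial_horner q y z m :
  \prod_(i < m) (y + q ^+ i * z) =
  \sum_(k < m.+1) (q ^+ 'C(k, 2) * qbin q m k * y ^+ (m - k)) * z ^+ k.
Proof.
have := congr1 (fun p => p.[z]) (q_binomial q y m).
rewrite horner_prod horner_sum => e.
transitivity (\prod_(i < m) (y%:P + q ^+ i *: 'X).[z]).
  by apply: eq_bigr => i _; rewrite !hornerE.
by rewrite e; apply: eq_bigr => i _; rewrite !hornerE.
Qed.

(* Since z is a root of the n-th factor, only the term where that factor is
   differentiated survives in the derivative of the product. *)
Lemma q_binomial_deriv q y z m (n : 'I_m) : y + q ^+ n * z = 0 ->
  q ^+ n * \prod_(i < m | i != n) (y + q ^+ i * z) =
  \sum_(k < m.+1) (q ^+ 'C(k, 2) * qbin q m k * y ^+ (m - k)) * (z ^+ k.-1 *+ k).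
Proof.
move=> z0; have := congr1 (fun p => p^`().[z]) (q_binomial q y m).
rewrite (bigD1 n) //= derivM hornerD !hornerM horner_prod.
rewrite derivD derivC derivZ derivX add0r !hornerE z0 mul0r addr0.
rewrite raddf_sum horner_sum => e.
transitivity (q ^+ n * \prod_(i < m | i != n) (y%:P + q ^+ i *: 'X).[z]).
  by congr (_ * _); apply: eq_bigr => i _; rewrite !hornerE.
rewrite e; apply: eq_bigr => i _.
by rewrite /= derivZ derivXn hornerZ hornerMn hornerXn.
Qed.

End QBinomial.

(** * Identities of Euler and Jacobi *)

Section ThetaSeries.
Variable R : comNzRingType.
Implicit Types (A : {poly R}) (d N m k n : nat).

(** Factors past the [N]-th are 1 modulo X^N, so any long enough product represents E_d to that
    precision. *)
Lemma eqt_qpochN d N m : (0 < d)%N -> (N <= m)%N ->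
  eqt N (qpoch ('X^d : {poly R}) m) (qpoch 'X^d N).
Proof.
move=> d0; elim: m => [|m IH].
  by rewrite leqn0 => /eqP->.
rewrite leq_eqVlt => /orP[/eqP->//|le]; apply: eqt_trans (IH le).
rewrite qpochS -[X in eqt _ _ X]mulr1; apply: eqtM => //.
by rewrite -exprM; apply: eqt_1subXn; nia.
Qed.

Lemma eqt_qpoch d N m k : (0 < d)%N -> (N <= m)%N -> (N <= k)%N ->
  eqt N (qpoch ('X^d : {poly R}) m) (qpoch 'X^d k).
Proof.
move=> d0 lem lek; apply: eqt_trans (eqt_sym _); exact: eqt_qpochN.
Qed.

Lemma coef0_qpoch d m : (0 < d)%N -> (qpoch ('X^d : {poly R}) m)`_0 = 1.
Proof.
move=> d0; apply: coef0_prod1 => i _; rewrite -exprM coef0_1subXn //.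
by rewrite muln_gt0 d0.
Qed.

(** Away from both ends, all three [qpoch] in the product formula agree modulo X^N; cancelling one
    shows that the Gaussian binomial is 1/E_d there. *)
Lemma eqt_qbin d N m k : (0 < d)%N -> (N <= k)%N -> (N + k <= m)%N ->
  eqt N (qbin 'X^d m k * qpoch ('X^d : {poly R}) N) 1.
Proof.
move=> d0 leNk lekm; apply: (@eqt_cancel R N _ _ (qpoch 'X^d N)).
  exact: coef0_qpoch.
rewrite mul1r -mulrA; apply: (@eqt_trans R N _ (qpoch 'X^d m)).
  rewrite -(@qbin_qpoch _ _ m k); last lia.
  by apply: eqtM => //; apply: eqtM; apply: eqt_sym; apply: eqt_qpochN => //; lia.
by apply: eqt_qpochN => //; lia.
Qed.

(** The passage to the limit: times [qpoch 'X^d N], a Gaussian binomial becomes 1 modulo X^N, except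
    near the ends, where [e k] is too large to matter. *)
Lemma coef_qbin_sum d N m (w : nat -> R) (e : nat -> nat) M A :
    (0 < d)%N -> (forall k, (k <= m)%N -> (M <= e k)%N) ->
    (forall k, (k <= m)%N ->
       (N <= k)%N && (N + k <= m)%N || (M + N <= e k)%N) ->
    (\sum_(k < m.+1) w k *: ('X^(e k) * qbin 'X^d m k)) * qpoch 'X^d N =
      'X^M * A ->
  forall i, (i < N)%N -> A`_i = \sum_(k < m.+1) w k *+ (e k == M + i)%N.
Proof.
move=> d0 leM cover eA i lt.
have := congr1 (fun p : {poly R} => p`_(M + i)) eA => /=.
rewrite coefXnM ltnNge leq_addr /= addKn => <-.
rewrite mulr_suml coef_sum; apply: eq_bigr => k _.
rewrite -scalerAl -mulrA coefZ coefXnM -mulr_natr; congr (_ * _).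
have lek : (k <= m)%N by rewrite -ltnS.
have := leM k lek; have /orP[/andP[h1 h2]|h] := cover k lek; last first.
  have -> : (e k == M + i)%N = false by lia.
  by have -> : (M + i < e k)%N by lia.
case: ltnP => [h3 _|h3 h4].
  by have -> : (e k == M + i)%N = false by lia.
rewrite (eqt_qbin d0 h1 h2) ?coef1; last by lia.
by congr (nat_of_bool _)%:R; lia.
Qed.

Lemma double_bin2 k : ('C(k, 2)%:Z * 2 = k%:Z * (k%:Z - 1))%R.
Proof.
elim: k => // k IH; rewrite binS bin1 PoszD mulrDl IH -[k.+1]addn1 PoszD; ring.
Qed.

(** Supplies the factors with exponent divisible by 3, which the finite pentagonal product lacks. *)
Lemma qpoch_mod3 n : qpoch ('X : {poly R}) (3 * n) =
  \prod_(i < n) ((1 - 'X^(3 * i + 1)) * (1 - 'X^(3 * i + 2))) * qpoch 'X^3 n.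
Proof.
elim: n => [|n IH]; first by rewrite muln0 /qpoch !big_ord0 mulr1.
rewrite mulnS addnC addn3 !qpochS IH big_ord_recr /= -exprM mulnS.
rewrite (_ : 3 * n + 1 = (3 * n).+1)%N; last lia.
rewrite (_ : 3 * n + 2 = (3 * n).+2)%N; last lia.
rewrite (_ : 3 + 3 * n = (3 * n).+3)%N; last lia.
by ring.
Qed.

Lemma prod_expr_nat (S : comNzRingType) (x : S) n :
  \prod_(i < n) x ^+ i = x ^+ 'C(n, 2).
Proof. by rewrite prodrXr -(big_mkord xpredT id) bin2_sum. Qed.

(* Taking q = X^3, y = X^(3n-1), z = -1 and m = 2n in the q-binomial theorem
   gives a finite form of Euler's pentagonal number theorem. *)
Lemma finite_pentagonal n : (0 < n)%N ->
  \prod_(i < n + n) ('X^(3 * n - 1) + ('X^3) ^+ i * -1) =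
  'X^(3 * 'C(n, 2) + (3 * n - 1) * n) * ((-1) ^+ n *
    \prod_(i < n) ((1 - 'X^(3 * i + 1)) * (1 - 'X^(3 * i + 2)))) :> {poly R}.
Proof.
move=> n0; rewrite big_split_ord /=.
(* The first n factors pull out -X^(3i) and, read backwards, leave exponents 2 mod 3; the last n
   pull out X^(3n-1) and leave exponents 1 mod 3. *)
rewrite (_ : \prod_(i < n) _ = \prod_(i < n) (-1 * ('X^3) ^+ i *
  (1 - 'X^(3 * (rev_ord i) + 2)))); last first.
  apply: eq_bigr => i _; have lt := ltn_ord i.
  rewrite (_ : 3 * n - 1 = 3 * i + (3 * (rev_ord i) + 2))%N; last by rewrite /=; lia.
  by rewrite exprD exprM; ring.
rewrite (_ : \prod_(i < n) ('X^(3 * n - 1) + ('X^3) ^+ (n + i) * -1) =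
   \prod_(i < n) ('X^(3 * n - 1) * (1 - 'X^(3 * i + 1)))); last first.
  apply: eq_bigr => i _; rewrite mulrBr mulr1 -exprM -exprD mulrN1.
  by congr (_ - 'X^_); lia.
rewrite !big_split /= !prodr_const card_ord prod_expr_nat.
rewrite (_ : \prod_(i < n) (1 - 'X^(3 * (n - i.+1) + 2)) =
             \prod_(i < n) (1 - 'X^(3 * i + 2))); last first.
  by rewrite [RHS](reindex_inj rev_ord_inj).
rewrite exprD !exprM; ring.
Qed.

(** For k = n + j the excess over the exponent at k = n is the pentagonal number j(3j-1)/2; doubling
    avoids the division. *)
Lemma pentagonal_exponent n k : (0 < n)%N -> (k <= n + n)%N ->
  (3 * 'C(k, 2) + (3 * n - 1) * (n + n - k))%N%:Z * 2 -
  (3 * 'C(n, 2) + (3 * n - 1) * n)%N%:Z * 2 =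
  (k%:Z - n%:Z) * ((k%:Z - n%:Z) * 3 - 1).
Proof.
move=> n0 le; have h1 := double_bin2 k; have h2 := double_bin2 n.
have h3 : (n + n - k)%:Z = n%:Z * 2 - k%:Z by lia.
have h4 : (3 * n - 1)%:Z = n%:Z * 3 - 1 by lia.
move: h1 h2 h3 h4.
move: 'C(k, 2) 'C(n, 2) (n + n - k)%N (3 * n - 1)%N => c c' b a h1 h2 h3 h4.
have -> : (3 * c + a * b)%N%:Z = 3 * c%:Z + a%:Z * b%:Z by lia.
have -> : (3 * c' + a * n)%N%:Z = 3 * c'%:Z + a%:Z * n%:Z by lia.
by rewrite h3 h4; lia.
Qed.

Lemma pentagonal_ge (j : int) :
  j * 2 <= j * (j * 3 - 1) /\ - j * 2 <= j * (j * 3 - 1).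
Proof. by case: (lerP j 0); nia. Qed.

(** If i = j(3j-1)/2 then 24i + 1 = (6j-1)^2; at other exponents no term of the finite sum
    contributes. *)
Lemma pentagonal_support N i : (i < N)%N -> (qpoch ('X : {poly R}) N)`_i != 0 ->
  exists j : int, i%:Z * 24 + 1 = (j * 6 - 1) ^+ 2.
Proof.
move=> lt nz.
(* An index within [N] of either end is then more than [N] away from [n], so its exponent is at
   least [M + N]. *)
pose n := (2 * N).+1; pose e k := (3 * 'C(k, 2) + (3 * n - 1) * (n + n - k))%N.
pose M := (3 * 'C(n, 2) + (3 * n - 1) * n)%N.
have eM k : (k <= n + n)%N ->
    (e k)%:Z * 2 - M%:Z * 2 = (k%:Z - n%:Z) * ((k%:Z - n%:Z) * 3 - 1).
  exact: pentagonal_exponent.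
have [/existsP[k /eqP ek]|/existsPn nek] :=
    boolP [exists k : 'I_(n + n).+1, e k == (M + i)%N].
  exists (k%:Z - n%:Z); have := eM k; rewrite ek -ltnS ltn_ord => /(_ isT) h.
  by lia.
case/negP: nz; pose A : {poly R} := (-1) ^+ n *
    \prod_(i < n) ((1 - 'X^(3 * i + 1)) * (1 - 'X^(3 * i + 2))) * qpoch 'X^3 N.
have A0 : A`_i = 0.
  rewrite (@coef_qbin_sum 3 N (n + n) (fun k => (-1) ^+ k) e M) //; first 1 last.
  - move=> k /eM; have [] := pentagonal_ge (k%:Z - n%:Z).
    by clear; generalize (e k) M ((k%:Z - n%:Z) * ((k%:Z - n%:Z) * 3 - 1)); lia.
  - move=> k /eM; have [] := pentagonal_ge (k%:Z - n%:Z).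
    clear; generalize (e k) M ((k%:Z - n%:Z) * ((k%:Z - n%:Z) * 3 - 1)).
    by rewrite /n; lia.
  - rewrite /A mulrA -finite_pentagonal // q_binomial_horner; congr (_ * _).
    apply: eq_bigr => k _.
    by rewrite /e exprD !exprM -mul_polyC rmorphXn rmorphN1; ring.
  by rewrite big1 // => k _; rewrite (negbTE (nek k)).
have : eqt N (qpoch ('X : {poly R}) N) ((-1) ^+ n * A).
  apply: (@eqt_trans _ _ _ (qpoch 'X (3 * n))).
    by apply: (@eqt_qpoch 1); rewrite /n; lia.
  rewrite qpoch_mod3 /A !mulrA -expr2 -exprM mulnC exprM sqrrN !expr1n mul1r.
  by apply: eqtM => //; apply: eqt_qpoch; rewrite /n; lia.
move=> /(_ i lt) ->; apply/eqP.
by rewrite -signr_odd; case: odd; rewrite ?mulN1r ?mul1r ?coefN A0 ?oppr0.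
Qed.

End ThetaSeries.

(* Taking q = X, y = X^n, z = -1 and m = 2n+1 in the derivative of the
   q-binomial theorem gives a finite form of Jacobi's identity for E_1^3. *)
Lemma finite_jacobi (R : comNzRingType) n :
  'X^('C(n, 2) + n * n + n) * ((-1) ^+ n * qpoch 'X n ^+ 2) =
  \sum_(k < (n + (1 + n)).+1)
    - ((-1) ^+ k * k%:R) *: ('X^('C(k, 2) + n * (n + (1 + n) - k)) *
    qbin 'X (n + (1 + n)) k) :> {poly R}.
Proof.
(* The factor at the middle index [n] is the one that vanishes; the length n + (1 + n) splits the
   product there. *)
pose o : 'I_(n + (1 + n)) := rshift n (lshift n ord0).
have oE : o = n :> nat by rewrite /= addn0.
have := @q_binomial_deriv {poly R} 'X 'X^n (-1) _ o.
rewrite oE mulrN1 subrr => /(_ erefl) e.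
transitivity ('X^n * \prod_(i < n + (1 + n) | i != o) ('X^n + 'X^i * -1 : {poly R})).
  rewrite big_split_ord big_split_ord /=.
  rewrite [X in _ * (_ * (X * _))]big_pred0; last first.
    by move=> i; rewrite (ord1 i) eqxx.
  rewrite mul1r (eq_bigl predT); last first.
    by move=> i; rewrite -val_eqE /=; have := ltn_ord i; lia.
  rewrite [X in _ * (_ * X)](eq_bigl predT); last first.
    by move=> i; rewrite -val_eqE /=; lia.
  rewrite (eq_bigr (fun i : 'I_n => -1 * 'X^i * (1 - 'X^((rev_ord i).+1)))); last first.
    move=> i _; have lt := ltn_ord i.
    rewrite {1}(_ : n = i + (rev_ord i).+1)%N; last by rewrite /=; lia.
    by rewrite exprD; ring.
  rewrite [X in _ * (_ * X)](eq_bigr (fun i : 'I_n => 'X^n * (1 - 'X^(i.+1))));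
    last first.
    move=> i _; rewrite mulrBr mulr1 -exprD mulrN1.
    by congr (_ - 'X^_); lia.
  rewrite !big_split /= !prodr_const card_ord prod_expr_nat.
  rewrite (_ : \prod_(i < n) (1 - 'X^((n - i.+1).+1)) = qpoch 'X n); last first.
    by rewrite [RHS](reindex_inj rev_ord_inj).
  by rewrite -/(qpoch 'X n) !exprD exprM; ring.
rewrite e; apply: eq_bigr => k _.
rewrite (_ : (-1) ^+ k.-1 *+ k = ((- ((-1) ^+ k * k%:R))%:P : {poly R})).
  by rewrite exprD exprM -mul_polyC; ring.
rewrite rmorphN rmorphM rmorphXn rmorphN1 rmorph_nat mulr_natr.
by case: (nat_of_ord k) => [|j]; rewrite ?mulr0n ?oppr0 // exprS mulN1r mulNrn opprK.
Qed.

(** The excess is now the triangular number j(j-1)/2, which is the same at j and 1 - j. *)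
Lemma jacobi_exponent n k : (k <= n + (1 + n))%N ->
  ('C(k, 2) + n * (n + (1 + n) - k))%N%:Z * 2 - ('C(n, 2) + n * n + n)%N%:Z * 2 =
  (k%:Z - n%:Z) * ((k%:Z - n%:Z) - 1).
Proof.
move=> le; have h1 := double_bin2 k; have h2 := double_bin2 n.
have h3 : (n + (1 + n) - k)%:Z = n%:Z * 2 + 1 - k%:Z by lia.
move: h1 h2 h3; move: 'C(k, 2) 'C(n, 2) (n + (1 + n) - k)%N => c c' b h1 h2 h3.
have -> : (c + n * b)%N%:Z = c%:Z + n%:Z * b%:Z by lia.
by rewrite h3; lia.
Qed.

Lemma jacobi_ge (j : int) : 0 <= j * (j - 1) /\
  (j * 3 - 4 <= j * (j - 1)) /\ (- j * 2 <= j * (j - 1)).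
Proof. by have := sqr_ge0 (j - 2); rewrite expr2; case: (lerP j 0); nia. Qed.

(** At i = j(j-1)/2 one has 8i + 1 = (2j-1)^2, and the coefficient is 2j-1 up to sign. Adding the
    sum to its reflection computes twice the coefficient, hence [2 != 0]. *)
Lemma jacobi_support (F : fieldType) N i : 2 != 0 :> F -> (i < N)%N ->
  (qpoch ('X : {poly F}) N ^+ 3)`_i != 0 ->
  exists2 j : int, i%:Z * 8 + 1 = (j * 2 - 1) ^+ 2 & (j * 2 - 1)%:~R != 0 :> F.
Proof.
move=> F2 lt nz.
(* n is kept opaque: its value would make powers of -1 unfold. *)
have [n nE] : exists n, n = (2 * N).+4 by exists (2 * N).+4.
pose m := (n + (1 + n))%N.
pose e k := ('C(k, 2) + n * (m - k))%N; pose M := ('C(n, 2) + n * n + n)%N.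
have eM k : (k <= m)%N ->
    (e k)%:Z * 2 - M%:Z * 2 = (k%:Z - n%:Z) * ((k%:Z - n%:Z) - 1).
  exact: jacobi_exponent.
have [/existsP[k /andP[/eqP ek k0]]|/existsPn nek] :=
    boolP [exists k : 'I_m.+1, (e k == M + i)%N &&
             (((k%:Z - n%:Z) * 2 - 1)%:~R != 0 :> F)].
  exists (k%:Z - n%:Z) => //; have := eM k; rewrite ek -ltnS ltn_ord => /(_ isT) h.
  by lia.
case/negP: nz; pose A : {poly F} := (-1) ^+ n * qpoch 'X n ^+ 2 * qpoch 'X N.
pose w k : F := - ((-1) ^+ k * k%:R).
have Ai : A`_i = \sum_(k < m.+1) w k *+ (e k == M + i)%N.
  apply: (@coef_qbin_sum F 1 N m) lt => //.
  - move=> k /eM; have [] := jacobi_ge (k%:Z - n%:Z).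
    by clear; generalize (e k) M ((k%:Z - n%:Z) * ((k%:Z - n%:Z) - 1)); lia.
  - move=> k /eM; have [] := jacobi_ge (k%:Z - n%:Z).
    clear -nE; generalize (e k) M ((k%:Z - n%:Z) * ((k%:Z - n%:Z) - 1)).
    by rewrite /m nE; lia.
  - by rewrite /A mulrA finite_jacobi.
(* The involution k |-> m - k fixes the exponents e k, so that each exponent gets
   the coefficient w k + w (m - k), which is 2 (k - n) - 1 up to sign. *)
have A0 : A`_i = 0.
  apply/eqP; rewrite -(mulIr_eq0 _ (mulIf F2)) mulr_natr mulr2n {1}Ai Ai.
  rewrite {2}(reindex_inj rev_ord_inj) -big_split big1 //= => k _.
  have le : (k <= m)%N by rewrite -ltnS.
  rewrite subSS (_ : e (m - k)%N = e k); last first.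
    have := eM _ le; have := eM _ (leq_subr k m).
    rewrite (_ : (m - k)%:Z = n%:Z * 2 + 1 - k%:Z); last by lia.
    by clear; generalize (e (m - k)%N) (e k) M n; lia.
  rewrite -mulrnDl; have := nek k; case: eqP => //= _ /negPn/eqP k0.
  rewrite mulr1n /w -signr_odd -[in X in _ + X]signr_odd oddB //.
  have -> : odd m by lia.
  rewrite addTb signrN mulNr opprK -mulrN -mulrDr natrB //.
  suff -> : - k%:R + (m%:R - k%:R) = - ((k%:Z - n%:Z) * 2 - 1)%:~R :> F.
    by rewrite k0 oppr0 mulr0.
  by rewrite rmorphB rmorphM rmorphB /= /m !natrD; ring.
have : eqt N (qpoch ('X : {poly F}) N ^+ 3) ((-1) ^+ n * A).
  rewrite /A !mulrA -exprD addnn -signr_odd odd_double mul1r exprSr.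
  apply: eqtM => //; apply: eqtX.
  by apply: (@eqt_qpoch _ 1); lia.
move=> /(_ i lt) ->; apply/eqP.
by rewrite -signr_odd; case: odd; rewrite ?mulN1r ?mul1r ?coefN A0 ?oppr0.
Qed.

(** * Regular partitions *)

Section RegularPartitions.
Variables (R : comNzRingType) (l n : nat).
Local Notation T := (n.-bseq 'I_n.+1).

Definition regular_part (p : T) : bool :=
  is_partition (parts p) && regular l (parts p).

(** Faithful to P only up to X^n, as [T] need not contain all larger partitions. *)
Definition regular_gf : {poly R} :=
  \sum_(p : T | regular_part p) 'X^(sumn (parts p)).

(** Distributivity indexes the terms of the power by functions from ['I_r] to [T], that is, by the
    tuples that [B] counts. *)
Lemma coef_regular_gfX r : (regular_gf ^+ r)`_n = (B l r n)%:R.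
Proof.
rewrite -{1}(card_ord r) -prodr_const.
rewrite (eq_bigl predT) // bigA_distr_big coef_sum /B -sum1_card natr_sum.
pose g (f : {ffun 'I_r -> T}) := [tuple f i | i < r].
have bg : bijective g.
  exists (fun L : r.-tuple T => [ffun i => tnth L i]) => [f|L].
    by apply/ffunP => i; rewrite ffunE tnth_mktuple.
  by apply: eq_from_tnth => i; rewrite tnth_mktuple ffunE.
rewrite [RHS](reindex g); last exact: onW_bij.
rewrite big_mkcond [RHS]big_mkcond; apply: eq_bigr => f _.
rewrite prodrXr coefXn inE /regular_multipartition big_tuple.
rewrite (_ : all _ _ = (f \in ffun_on regular_part)); last first.
  apply/all_tnthP/ffun_onP => h i.
    by have := h i; rewrite tnth_map tnth_mktuple.
  by rewrite tnth_map tnth_mktuple; apply: h.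
rewrite [in RHS](eq_bigr (fun i => sumn (parts (f i)))); last first.
  by move=> i _; rewrite tnth_map tnth_mktuple.
by case: (f \in _); rewrite //= eq_sym; case: eqP.
Qed.

Lemma parts_le (p : T) x : x \in parts p -> (x < n.+1)%N.
Proof. by case/mapP => y _ ->; apply: ltn_ord. Qed.

Lemma sumn_count_mem (s : seq nat) : {in s, forall x, x < n.+1}%N ->
  sumn s = (\sum_(i < n) i.+1 * count_mem i.+1 s)%N.
Proof.
elim: s => [|x s IH] sn; first by rewrite big1 // => i _; rewrite muln0.
rewrite /= IH; last by move=> y ys; apply: sn; rewrite inE ys orbT.
under [RHS]eq_bigr => i _ do rewrite mulnDr.
rewrite [RHS]big_split; congr (_ + _)%N.
case: x {IH} sn => [|x] sn; first by rewrite big1 // => i _; rewrite muln0.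
have lt : (x < n)%N by have := sn x.+1; rewrite inE eqxx => /(_ isT).
rewrite (bigD1 (Ordinal lt)) //= eqxx muln1 big1 ?addn0 // => i ne.
rewrite eqSS (_ : (x == i :> nat) = false) ?muln0 //.
by apply: contraNF ne => /eqP e; apply/eqP/val_inj.
Qed.

(** [inord] loses nothing, as [p] has at most [n] entries. *)
Definition mults (p : T) : {ffun 'I_n -> 'I_n.+1} :=
  [ffun i : 'I_n => inord (count_mem i.+1 (parts p))].

Lemma multsE p i : mults p i = count_mem i.+1 (parts p) :> nat.
Proof.
rewrite ffunE inordK // ltnS (leq_trans (count_size _ _)) //.
by rewrite size_map size_bseq.
Qed.

Lemma mults_inj : {in regular_part &, injective mults}.
Proof.
move=> p p' /andP[/andP[sp p0] _] /andP[/andP[sp' p'0] _] e.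
apply: parts_inj; apply: (@sorted_eq _ geq) => //.
- by move=> x y z h1 h2; apply: leq_trans h1.
- by move=> x y; rewrite andbC => /anti_leq.
apply/allP => x xs; apply/eqP.
case: x xs => [|x] xs; first by rewrite !(count_memPn _).
have lt : (x < n)%N.
  by move: xs; rewrite mem_cat => /orP[] /parts_le.
by rewrite /= -(multsE p (Ordinal lt)) e multsE.
Qed.

Definition mult_ok (i : 'I_n) : pred 'I_n.+1 :=
  fun j => (l %| i.+1)%N ==> (j == ord0).

(** Conversely, sorting the parts repeated according to [f] rebuilds a partition, which fits in [T]
    because k <= n. *)
Lemma mults_imset k : (k <= n)%N ->
  mults @: [set p : T | regular_part p & sumn (parts p) == k] =
  [set f in family mult_ok | (\sum_(i < n) i.+1 * f i)%N == k].
Proof.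
move=> lek; apply/setP => f; rewrite !inE.
apply/imsetP/andP => [[p + ->]|[/familyP fQ /eqP fk]].
  rewrite inE => /andP[/andP[_ /allP rp] /eqP <-]; split.
    apply/familyP => i; apply/implyP => li; rewrite -val_eqE /= multsE.
    by apply/eqP/count_memPn/negP => /rp; rewrite li.
  apply/eqP; under eq_bigr => i _ do rewrite multsE.
  by rewrite -sumn_count_mem // => x /parts_le.
pose s := flatten [seq nseq (f i) i.+1 | i <- enum 'I_n].
have sP x : x \in s -> exists2 i : 'I_n, x = i.+1 & (0 < f i)%N.
  case/flatten_mapP => i _; rewrite mem_nseq => /andP[f0 /eqP ->].
  by exists i.
have sC (i : 'I_n) : count_mem i.+1 s = f i.
  rewrite count_flatten -map_comp sumnE big_map big_enum /=.
  rewrite (bigD1 i) //= count_nseq /= eqxx mul1n big1 ?addn0 // => j ne.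
  by rewrite count_nseq /= eqSS val_eqE (negbTE ne) mul0n.
have sS : sumn s = k.
  rewrite sumn_count_mem => [|x /sP[i -> _]]; last by rewrite !ltnS.
  by rewrite -fk; apply: eq_bigr => i _; rewrite sC.
have pe : perm_eq (sort geq s) s by rewrite perm_sort.
have sp : is_partition (sort geq s).
  apply/andP; split; first by apply: sort_sorted => x y; apply: leq_total.
  by rewrite mem_sort; apply/negP => /sP[].
have pS : sumn (sort geq s) = k by rewrite (perm_sumn pe) sS.
have [q qE] : exists q : T, parts q = sort geq s by apply: parts_onto; rewrite ?pS.
exists q.
  rewrite inE /regular_part qE pS eqxx andbT sp /=.
  apply/allP => x; rewrite mem_sort => /sP[i -> f0].
  by apply/negP => li; have := implyP (fQ i) li; move=> /eqP e; rewrite e in f0.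
apply/ffunP => i; apply: val_inj; rewrite /= multsE qE -sC.
by move/permP: pe => ->.
Qed.

Lemma regular_gf_prod :
  eqt n.+1 regular_gf (\prod_(i < n) \sum_(j | mult_ok i j) 'X^(i.+1 * j)).
Proof.
move=> k; rewrite ltnS => lek; rewrite bigA_distr_big_dep !coef_sum.
transitivity (#|[set p : T | regular_part p & sumn (parts p) == k]|%:R : R).
  rewrite -sum1_card natr_sum big_mkcond [RHS]big_mkcond; apply: eq_bigr => p _.
  by rewrite inE coefXn eq_sym; case: regular_part; case: eqP.
rewrite -(card_in_imset (f := mults)); last first.
  by move=> p p'; rewrite !inE => /andP[h _] /andP[h' _]; apply: mults_inj.
rewrite mults_imset // -sum1_card natr_sum big_mkcond [RHS]big_mkcond.
apply: eq_bigr => f _; rewrite inE prodrXr coefXn eq_sym.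
by case: (f \in _); case: eqP.
Qed.

(** A geometric sum times its factor is 1 - X^((i+1)(n+1)), which is 1 at this precision; at
    multiples of [l] the sum is 1 and the factor survives. *)
Lemma regular_gf_qpoch : eqt n.+1 (regular_gf * qpoch 'X n)
  (\prod_(i < n | (l %| i.+1)%N) (1 - 'X^(i.+1))).
Proof.
apply: eqt_trans (eqtM regular_gf_prod (fun _ _ => erefl _)) _.
rewrite /qpoch -big_split [X in eqt _ _ X]big_mkcond; apply: eqt_prod => i _ /=.
rewrite /mult_ok; case: ifP => li.
  by rewrite big_pred1_eq muln0 expr0 mul1r.
have := subrX1 ('X^(i.+1) : {poly R}) n.+1.
rewrite -exprM => e.
rewrite (_ : _ * _ = 1 - 'X^(i.+1 * n.+1)).
  by apply: eqt_1subXn; nia.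
rewrite -[RHS]opprB e -mulNr opprB mulrC; congr (_ * _).
by apply: eq_bigr => j _; rewrite exprM.
Qed.

End RegularPartitions.

(** * Frobenius and the reduction to E_1^s *)

Lemma supp_qpoch_exp_prime (p m k : nat) : prime p ->
  supp p ((qpoch ('X : {poly 'F_p}) m ^+ p) ^+ k).
Proof.
move=> pp; apply: suppX; rewrite -prodrXl; apply: supp_prod => i _.
have pcharp : p \in [pchar {poly 'F_p}] by rewrite pchar_poly pchar_Fp.
have := pFrobenius_autB_comm pcharp (commr_sym (commr1 'X^(i.+1))).
rewrite !pFrobenius_autE expr1n -exprM => ->.
by apply: supp_1subXn; rewrite dvdn_mull.
Qed.

(** Modulo X^(n+1), P^r Q^(pk) = (PQ)^r Q^s = S^r Q^s, where Q^(pk) and S^r are series in X^p. *)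
Lemma dvdn_B (p l r s k n : nat) : prime p -> (p %| l)%N -> (r + s = p * k)%N ->
  (forall i, (i < n.+1)%N -> i = n %[mod p] ->
     (qpoch ('X : {poly 'F_p}) n.+1 ^+ s)`_i = 0) ->
  (p %| B l r n)%N.
Proof.
move=> pp pl rs van; rewrite (dvdn_pcharf (pchar_Fp pp)) -coef_regular_gfX.
set P := regular_gf _ _ _; pose Q : {poly 'F_p} := qpoch 'X n.+1.
pose S : {poly 'F_p} := \prod_(i < n | (l %| i.+1)%N) (1 - 'X^(i.+1)).
(* [Q] has one factor more than in [regular_gf_qpoch]; it is 1 modulo X^(n+1). *)
have PQ : eqt n.+1 (P * Q) S.
  apply: (eqt_trans _ (@regular_gf_qpoch _ l n)); apply: eqtM => //.
  rewrite /Q qpochS -[X in eqt _ _ X]mulr1; apply: eqtM => //.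
  exact: eqt_1subXn.
have suppS : supp p (S ^+ r).
  apply: suppX; apply: supp_prod => i li; apply: supp_1subXn.
  exact: dvdn_trans li.
have e : eqt n.+1 (P ^+ r * (Q ^+ p) ^+ k) (Q ^+ s * S ^+ r).
  rewrite -exprM -rs exprD mulrA -exprMn mulrC.
  by apply: eqtM => //; apply: eqtX.
apply/eqP; apply: (class_cancel (supp_qpoch_exp_prime n.+1 k pp) _ _ (ltnSn n) erefl).
  rewrite -exprM; elim: (p * k)%N => [|a IH]; first by rewrite coef1.
  by rewrite exprS coef0M IH mulr1; apply: (@coef0_qpoch _ 1).
by move=> i lt ic; rewrite e //; apply: class_mulr lt ic.
Qed.

(** * Squares and vanishing coefficients modulo 5 and 11 *)

Lemma sqrz_mod5 (x : int) :
  exists2 a : int, x ^+ 2 = a * 5 \/ x ^+ 2 = a * 5 + 1 \/ x ^+ 2 = a * 5 + 4 &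
    x ^+ 2 = a * 5 -> (5 %| x)%Z.
Proof.
pose a := (x %/ 5)%Z; have : x = a * 5 \/ x = a * 5 + 1 \/ x = a * 5 + 2 \/
  x = a * 5 + 3 \/ x = a * 5 + 4 by rewrite /a; lia.
rewrite expr2 => -[|[|[|[|]]]] ->.
- by exists (a * a * 5); [lia|rewrite dvdz_mull].
- by exists (a * a * 5 + a * 2); lia.
- by exists (a * a * 5 + a * 4); lia.
- by exists (a * a * 5 + a * 6 + 1); lia.
- by exists (a * a * 5 + a * 8 + 3); lia.
Qed.

Lemma sqrz_mod11 (x : int) : exists a : int,
  x ^+ 2 = a * 11 \/ x ^+ 2 = a * 11 + 1 \/ x ^+ 2 = a * 11 + 3 \/
  x ^+ 2 = a * 11 + 4 \/ x ^+ 2 = a * 11 + 5 \/ x ^+ 2 = a * 11 + 9.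
Proof.
pose a := (x %/ 11)%Z; pose b := x - a * 11.
exists (a * a * 11 + a * b * 2 + (b * b %/ 11)%Z).
have -> : x ^+ 2 = (a * a * 11 + a * b * 2) * 11 + b * b by rewrite /b; ring.
have : b = 0 \/ b = 1 \/ b = 2 \/ b = 3 \/ b = 4 \/ b = 5 \/ b = 6 \/ b = 7 \/
  b = 8 \/ b = 9 \/ b = 10 by rewrite /b /a; lia.
move: (a * a * 11) (a * b * 2) => c d.
by do 10?[case=> [->|]]; last move=> ->; lia.
Qed.

(** 24i + 1 = 1 - i modulo 5, a nonsquare for i = 3, 4. *)
Lemma coef_qpoch_mod5 N i : (i < N)%N -> (2 < i %% 5)%N ->
  (qpoch ('X : {poly 'F_5}) N)`_i = 0.
Proof.
move=> lt im; apply/eqP/negPn/negP => /(pentagonal_support lt) [j].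
by have [a + _] := sqrz_mod5 (j * 6 - 1); lia.
Qed.

(** 8i + 1 = 3i + 1 modulo 5 is a nonsquare for i = 2, 4; for i = 3 it is 0, so 5 divides Jacobi's
    coefficient 2j-1. *)
Lemma coef_qpoch3_mod5 N i : (i < N)%N -> (1 < i %% 5)%N ->
  (qpoch ('X : {poly 'F_5}) N ^+ 3)`_i = 0.
Proof.
move=> lt im; apply/eqP/negPn/negP => nz.
have [//|j e /negP[]] := jacobi_support _ lt nz.
have [a h dv] := sqrz_mod5 (j * 2 - 1).
have /dv/dvdzP[b ->] : (j * 2 - 1) ^+ 2 = a * 5 by lia.
by rewrite rmorphM /= (_ : 5%:~R = 0 :> 'F_5) ?mulr0 //; apply/val_inj.
Qed.

(** E_1 lives in the classes 0, 1, 2 and E_1^3 in 0, 1, so residues add up to at most 3. *)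
Lemma coef_qpoch4_mod5 N i : (i < N)%N -> (i %% 5 = 4)%N ->
  (qpoch ('X : {poly 'F_5}) N ^+ 4)`_i = 0.
Proof.
move=> lt im; rewrite exprS coefM big1 // => j _; have := ltn_ord j => lej.
case: (ltnP 2 (j %% 5)) => h; first by rewrite coef_qpoch_mod5 ?mul0r //; lia.
by rewrite coef_qpoch3_mod5 ?mulr0 //; lia.
Qed.

(** 24i + 1 = 2i + 1 modulo 11 takes the nonsquare values 7, 2, 6, 8, 10 on the listed classes. *)
Lemma coef_qpoch_mod11 N i : (i < N)%N ->
  (i %% 11)%N \in [:: 3; 6; 8; 9; 10] ->
  (qpoch ('X : {poly 'F_11}) N)`_i = 0.
Proof.
move=> lt; rewrite !inE => im; apply/eqP/negPn/negP => /(pentagonal_support lt) [j].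
by have [a] := sqrz_mod11 (j * 6 - 1); lia.
Qed.

Lemma eqn0_mod55 m : (5 %| m)%N -> (11 %| m)%N -> m = 0 %[mod 55].
Proof.
by move=> d5 d11; apply/eqP; rewrite mod0n -/(dvdn 55 m) (@Gauss_dvd 5 11) ?d5.
Qed.

(** All three families have r = -1 modulo 11, so s = 1 serves them all. *)
Lemma dvdn11_B (r k m : nat) : (r + 1 = 11 * k)%N ->
  (m %% 11)%N \in [:: 3; 6; 8; 9; 10] -> (11 %| B 55 r m)%N.
Proof.
move=> rk mm; apply: (dvdn_B (p := 11) _ _ rk) => // i lt im.
by rewrite expr1 coef_qpoch_mod11 // im.
Qed.

Local Close Scope ring_scope.

Theorem theorem1p7 (n t : nat) :
  (forall a : nat, a \in [:: 9; 14; 19; 39; 54] ->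
     B 55 (55 * t + 21) (55 * n + a) = 0 %[mod 55]) /\
  (forall a : nat,
     a \in [:: 3; 8; 9; 14; 17; 19; 28; 32; 39; 42; 43; 47; 52; 53; 54] ->
     B 55 (55 * t + 32) (55 * n + a) = 0 %[mod 55]) /\
  (forall a : nat, a \in [:: 3; 8; 9; 14; 19; 28; 39; 43; 53; 54] ->
     B 55 (55 * t + 54) (55 * n + a) = 0 %[mod 55]).
Proof.
split; [|split] => a; rewrite !inE => am; apply: eqn0_mod55.
(* Modulo 5, r is -4, -3 and -1 in the three cases, so s is 4, 3 and 1. *)
- apply: (dvdn_B (p := 5) (s := 4) (k := 11 * t + 5)) => //; first lia.
  by move=> i lt im; apply: coef_qpoch4_mod5 => //; lia.
- by apply: (@dvdn11_B _ (5 * t + 2)); rewrite ?inE; lia.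
- apply: (dvdn_B (p := 5) (s := 3) (k := 11 * t + 7)) => //; first lia.
  by move=> i lt im; apply: coef_qpoch3_mod5 => //; lia.
- by apply: (@dvdn11_B _ (5 * t + 3)); rewrite ?inE; lia.
- apply: (dvdn_B (p := 5) (s := 1) (k := 11 * t + 11)) => //; first lia.
  by move=> i lt im; rewrite expr1; apply: coef_qpoch_mod5 => //; lia.
- by apply: (@dvdn11_B _ (5 * t + 5)); rewrite ?inE; lia.
Qed.
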